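(* Let $A$ be a fixed $s \times t$ binary matrix. There exists a polynomial $p$ (depending only on $A$) such that for every $\epsilon > 0$ the following holds with $\delta = 1/p(\epsilon^{-1})$: if an $n \times n$ binary matrix $M$ contains $\epsilon n^2$ pairwise-disjoint copies of $A$, then the total number of copies of $A$ in $M$ is at least $\delta n^{s+t}$.
   Context: An $m\times n$ matrix over an alphabet $\Gamma$ is a function $M:[m]\times[n]\to\Gamma$; binary means $\Gamma=\{0,1\}$. A submatrix of $M$ is obtained by deleting some rows and columns while preserving the row and column order: for row indices $r_1<\dots<r_s$ and column indices $c_1<\dots<c_t$, the submatrix on $\{r_1,\dots,r_s\}\times\{c_1,\dots,c_t\}$ has $(i,j)$ entry $M(r_i,c_j)$. A copy of $A$ in $M$ is an $s\times t$ submatrix of $M$ equal to $A$. A set of copies is pairwise disjoint if every entry (position) of $M$ is contained in at most one of the copies. *)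

(* Defs.v *)
From HB Require Import structures.
From mathcomp Require Import all_boot all_order all_algebra.
From mathcomp Require Import reals.
Set Implicit Arguments. Unset Strict Implicit. Unset Printing Implicit Defensive.

Definition incr (k n : nat) (f : {ffun 'I_k -> 'I_n}) : bool :=
  [forall i : 'I_k, forall j : 'I_k, (i < j) ==> (f i < f j)].

(* A copy location: chosen rows r_1<..<r_s and columns c_1<..<c_t *)
Definition loc (s t n : nat) := ({ffun 'I_s -> 'I_n} * {ffun 'I_t -> 'I_n})%type.

Definition is_copy (s t n : nat) (A : 'M[bool]_(s, t)) (M : 'M[bool]_(n, n))
  (c : loc s t n) : bool :=
  [&& incr c.1, incr c.2 &
      [forall i : 'I_s, forall j : 'I_t, M (c.1 i) (c.2 j) == A i j]].

Definition positions (s t n : nat) (c : loc s t n) : {set 'I_n * 'I_n} :=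
  [set (c.1 i, c.2 j) | i : 'I_s, j : 'I_t].

Definition disjoint_copies (s t n : nat) (A : 'M[bool]_(s, t))
  (M : 'M[bool]_(n, n)) (C : {set loc s t n}) : Prop :=
  (forall c, c \in C -> is_copy A M c) /\
  (forall c1 c2, c1 \in C -> c2 \in C -> c1 != c2 ->
     [disjoint positions c1 & positions c2]).

Definition num_copies (s t n : nat) (A : 'M[bool]_(s, t)) (M : 'M[bool]_(n, n)) : nat :=
  #|[set c : loc s t n | is_copy A M c]|.

(* Main.v *)
Require Import Defs.
From HB Require Import structures.
From mathcomp Require Import all_boot all_order all_algebra.
From mathcomp Require Import reals zify.
Set Implicit Arguments. Unset Strict Implicit. Unset Printing Implicit Defensive.

(** Write [1/Q] for the density of disjoint copies, and fix small parameters
    that are polynomial in [1/Q].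

    Either polynomially many rows [z] suffice as cluster centers (all but few
    rows of [M] agree with some [z] on almost all columns), or one can keep
    picking rows far from all rows picked so far.  In the second case a random
    set of columns tells the picked rows apart, so by Sauer-Shelah-Pajor the
    sampled rows shatter many columns; [s] disjoint blocks of shattered columns
    are enough to find an ordered copy of [A] whatever the order of the rows,
    and averaging over the samples gives polynomially many copies.

    In the first case, cut the rows into [B^k] intervals for [k = 0, ..., s],
    and let the level-[k] cell of a row be the part of its cluster lying in its
    level-[k] interval.  For all but few of the disjoint copies, with rows
    [x_0 < ... < x_(s-1)], [x_i] is not near the bottom of its level-[i] cell,
    and each of its columns is almost constant, with the right value, on that
    cell.  Replace [x_i] by any row of the level-[i] cell which lies strictly
    below the level-[i+1] interval of [x_i]: since intervals are nested, the new
    rows are automatically increasing, and they form a positive proportion of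
    the cell, so that the columns remain almost constant on them.  By pigeonhole
    many copies share all their cells, and a quantile argument recombines their
    columns into many increasing tuples. *)

(** * Shattered sets and the Sauer-Shelah-Pajor bound *)

Section Shattering.
Variable T : finType.
Implicit Types (F : {set {set T}}) (S U V : {set T}).

Definition shatters F S : bool :=
  [forall U : {set T}, (U \subset S) ==> [exists V in F, V :&: S == U]].

Lemma shattersP F S :
  reflect (forall U, U \subset S -> exists2 V, V \in F & V :&: S = U)
          (shatters F S).
Proof.
apply: (iffP forallP) => [h U sU | h U].
  by have /implyP/(_ sU)/exists_inP[V VF /eqP] := h U; exists V.
by apply/implyP => /h[V VF e]; apply/exists_inP; exists V; rewrite ?e.
Qed.

Lemma shatters_mono F F' S : F \subset F' -> shatters F S -> shatters F' S.
Proof.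
move=> /subsetP sF /shattersP h; apply/shattersP => U /h[V VF e].
by exists V; first exact: sF.
Qed.

Lemma shatters_nonconst F S x : x \in S -> shatters F S ->
  (exists2 V, V \in F & x \in V) /\ (exists2 V, V \in F & x \notin V).
Proof.
move=> xS /shattersP h; split.
  have [V VF e] := h S (subxx _); exists V => //.
  by move: xS; rewrite -{1}e inE => /andP[].
have [V VF e] := h set0 (sub0set _); exists V => //.
by apply/negP => xV; have := in_set0 x; rewrite -e inE xV xS.
Qed.

(** Induction on [#|F|], splitting [F] by an element [x] on which two members differ. A set
    shattered by either half is shattered by [F] and avoids [x]; a set [S] shattered by both halves
    also yields [x |: S], so nothing is lost in the count. *)
Lemma pajor F : #|F| <= #|[set S | shatters F S]|.
Proof.
have [n] := ubnP #|F|; elim: n F => // n IH F; rewrite ltnS => leFn.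
have [le1 | /card_gt1P[V1 [V2 [V1F V2F neV]]]] := leqP #|F| 1.
  have [->|[V VF]] := set_0Vmem F; first by rewrite cards0.
  apply: leq_trans le1 _; rewrite card_gt0; apply/set0Pn; exists set0.
  rewrite inE; apply/shattersP => U; rewrite subset0 => /eqP->.
  by exists V; rewrite ?setI0.
have [x nex] : exists x, (x \in V1) != (x \in V2).
  apply/existsP; rewrite -negb_forall; apply: contra neV => /forallP h.
  by apply/eqP/setP => x; apply/eqP.
have [W1 W1F xW1] : exists2 V, V \in F & x \in V.
  by move: nex; case h1: (x \in V1); [exists V1 | case h2: (x \in V2) => // _; exists V2].
have [W0 W0F xW0] : exists2 V, V \in F & x \notin V.
  by move: nex; case h1: (x \in V1); case h2: (x \in V2) => // _;
    [exists V2 | exists V1]; rewrite ?h1 ?h2.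
pose P := [set V : {set T} | x \in V].
have ltF1 : #|F :&: P| < #|F|.
  by apply/proper_card/properP; split; [exact: subsetIl | exists W0; rewrite ?inE ?(negPf xW0) ?andbF].
have ltF0 : #|F :\: P| < #|F|.
  by apply/proper_card/properP; split; [exact: subsetDl | exists W1; rewrite ?inE ?xW1].
have IH1 := IH _ (leq_trans ltF1 leFn); have IH0 := IH _ (leq_trans ltF0 leFn).
set S1 := [set S | _] in IH1; set S0 := [set S | _] in IH0.
have no1 S : S \in S1 -> x \notin S.
  rewrite inE => h; apply/negP => xS.
  by have [_ [V]] := shatters_nonconst xS h; rewrite !inE => /andP[_ ->].
have no0 S : S \in S0 -> x \notin S.
  rewrite inE => h; apply/negP => xS.
  by have [[V]] := shatters_nonconst xS h; rewrite !inE => /andP[/negPf->].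
rewrite -(cardsID P F); apply: leq_trans (leq_add IH1 IH0) _.
rewrite -cardsUI; set I := S1 :&: S0.
have -> : #|I| = #|[set x |: S | S in I]|.
  rewrite card_in_imset // => A B; rewrite !inE => /andP[A1 _] /andP[B1 _] e.
  have nA := no1 A; have nB := no1 B; rewrite !inE in nA nB.
  by rewrite -(setU1K (nA A1)) e (setU1K (nB B1)).
have dis : [disjoint S1 :|: S0 & [set x |: S | S in I]].
  rewrite disjoint_sym disjoint_subset; apply/subsetP => _ /imsetP[S _ ->].
  by rewrite inE; apply/negP => /setUP[/no1|/no0]; rewrite setU11.
move: (leq_card_setU (S1 :|: S0) [set x |: S | S in I]).2; rewrite dis => /eqP <-.
apply/subset_leq_card/subsetP => S; case/setUP => [/setUP[]|/imsetP[S' S'I ->]];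
  rewrite ?inE.
- by apply: shatters_mono; exact: subsetIl.
- by apply: shatters_mono; exact: subsetDl.
move: S'I; rewrite inE => /andP[S'1 S'0].
have xS' := no1 _ S'1; move: S'1 S'0; rewrite !inE => /shattersP h1 /shattersP h0.
apply/shattersP => U sU.
have sU' : U :\ x \subset S' by rewrite subDset.
have [xU|xU] := boolP (x \in U).
  have [V] := h1 _ sU'; rewrite !inE => /andP[VF xV] e; exists V => //.
  by rewrite setIUr e (setIidPr _) ?sub1set // setD1K.
have [V] := h0 _ sU'; rewrite !inE => /andP[xV VF] e; exists V => //.
rewrite setIUr e [V :&: [set x]](_ : _ = set0) ?set0U.
  by apply/setDidPl; rewrite disjoint_sym disjoints1.
by apply/setP => y; rewrite !inE; apply/andP => -[yV /eqP yx]; rewrite -yx yV in xV.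
Qed.

(** Lists of [d] optional elements cover these sets, with [None] as padding. *)
Lemma card_small_sets d : #|[set S : {set T} | #|S| <= d]| <= #|T|.+1 ^ d.
Proof.
pose img (f : {ffun 'I_d -> option T}) := [set x | Some x \in codom f].
have /subset_leq_card : [set S : {set T} | #|S| <= d] \subset
    [set img f | f : {ffun 'I_d -> option T}].
  apply/subsetP => S; rewrite inE => leS; apply/imsetP.
  exists [ffun i : 'I_d => nth None [seq Some x | x <- enum S] i] => //.
  apply/setP => x; rewrite inE; apply/idP/codomP => [xS | [i]]; rewrite ?ffunE.
    have ix : index x (enum S) < size (enum S) by rewrite index_mem mem_enum.
    have ixd : index x (enum S) < d by apply: leq_trans ix _; rewrite -cardE.
    by exists (Ordinal ixd); rewrite ffunE /= (nth_map x) // nth_index // mem_enum.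
  have [lti|gei] := ltnP i (size (enum S)); last by rewrite nth_default ?size_map.
  by rewrite (nth_map x) // => -[->]; rewrite -mem_enum mem_nth.
move=> /leq_trans; apply; apply: leq_trans (leq_imset_card _ _) _.
by rewrite card_ffun card_option card_ord.
Qed.

Lemma large_shattered F d : #|T|.+1 ^ d < #|F| -> exists2 S, shatters F S & d < #|S|.
Proof.
move=> ltF; apply/exists_inP; rewrite -[X in is_true X]negbK; apply/negP.
rewrite negb_exists_in => /forall_inP h.
suff : #|F| <= #|T|.+1 ^ d by rewrite leqNgt ltF.
apply: leq_trans (pajor F) _; apply: leq_trans (card_small_sets d).
by apply/subset_leq_card/subsetP => S; rewrite !inE => /h; rewrite -leqNgt.
Qed.

End Shattering.

(** * Ordered blocks, and copies among pairwise distinct rows *)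

Section OrderedBlocks.
Variables (I V : finType) (w : {ffun I -> V} -> nat).
Hypothesis w_inj : injective w.

(* The block [b1] is the one whose first occurrence of the label [v] comes last:
   once its label is frozen to [v], every remaining assignment is placed after
   an occurrence of [v] in each of the other blocks. *)
Lemma ordered_block v (ss : seq V) (B : {set I}) (f0 : {ffun I -> V}) :
  uniq (v :: ss) -> size ss < #|B| ->
  exists2 b, b \in B & exists fs : seq {ffun I -> V},
    [/\ [seq f b | f : {ffun I -> V} <- fs] = v :: ss,
        sorted (fun f g => w f < w g) fs
      & all (fun f : {ffun I -> V} => [forall c, (c \notin B) ==> (f c == f0 c)]) fs].
Proof.
elim: ss v B f0 => [|v' ss IH] v B f0 us ltB.
  have /card_gt0P[b bB] : 0 < #|B| by case: #|B| ltB.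
  exists b => //; exists [:: [ffun c => if c == b then v else f0 c]]; split => //=.
    by rewrite ffunE eqxx.
  rewrite andbT; apply/forallP => c; apply/implyP => cB; rewrite ffunE.
  by case: (c =P b) cB => [->|_ _]; rewrite ?bB.
pose P b (f : {ffun I -> V}) := (f b == v) && [forall c, (c \notin B) ==> (f c == f0 c)].
pose dflt b : {ffun I -> V} := [ffun c => if c == b then v else f0 c].
have Pd b : b \in B -> P b (dflt b).
  move=> bB; rewrite /P ffunE eqxx eqxx /=; apply/forallP => c; apply/implyP => cB.
  by rewrite ffunE; case: (c =P b) cB => [->|_ _]; rewrite ?bB.
pose first b := [arg min_(f < dflt b | P b f) w f].
have firstP b : b \in B -> P b (first b) /\ forall f, P b f -> w (first b) <= w f.
  by move=> bB; rewrite /first; case: arg_minnP => [|f Pf minf]; [exact: Pd | split].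
have /card_gt0P[b0 b0B] : 0 < #|B| by case: #|B| ltB.
have [b1 b1B max1] : exists2 b1, b1 \in B & forall b, b \in B -> w (first b) <= w (first b1).
  by case: (@arg_maxnP _ b0 (mem B) (w \o first) b0B) => b1 b1B h; exists b1.
have ltB' : size ss < #|B :\ b1| by move: ltB; rewrite (cardsD1 b1) b1B.
have us' : uniq (v' :: ss) by case/andP: us.
(* Freezing [b1] through [dflt b1] makes every assignment in [fs] satisfy [P b1], so it comes no
   earlier than [first b1], hence no earlier than [first b]. *)
have [b bB [fs [mfs sfs afs]]] := IH v' (B :\ b1) (dflt b1) us' ltB'.
have bB' : b \in B by move: bB; rewrite inE => /andP[].
case: fs mfs sfs afs => // f fs [fb mfs] sfs afs.
have offB g : g \in f :: fs -> P b1 g.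
  move=> /(allP afs)/forallP h; apply/andP; split.
    by have /implyP/(_ _)/eqP-> := h b1; rewrite ?ffunE ?eqxx // !inE eqxx.
  apply/forallP => c; apply/implyP => cB.
  have /implyP/(_ _)/eqP-> := h c; last by rewrite !inE (negPf cB) andbF.
  by rewrite ffunE; case: (c =P b1) cB => [->|_ _]; rewrite ?b1B.
have [Pb _] := firstP b bB'; have [_ min1] := firstP b1 b1B.
exists b => //; exists (first b :: f :: fs); split.
- by rewrite /= fb mfs; case/andP: Pb => /eqP->.
- apply/andP; split => //; rewrite ltn_neqAle; apply/andP; split.
    apply/eqP => /w_inj e; case/andP: Pb => /eqP; rewrite e fb => ev _.
    by move: us; rewrite ev /= inE eqxx.
  by apply: leq_trans (max1 _ bB') _; apply: min1; apply: offB; rewrite inE eqxx.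
- apply/allP => g; rewrite inE => /predU1P[->|/offB/andP[]//].
  by case/andP: Pb.
Qed.

End OrderedBlocks.

(** The distinct row patterns shatter more than [s * (s + t)] columns, enough for [s] blocks of [s]
    label columns and [t] columns for [A]. Every assignment of labels to blocks is realised by a
    row, and [ordered_block] finds a block in which all labels occur in increasing row order. *)
Lemma distinct_rows_copy s t n m r (A : 'M[bool]_(s, t)) (M : 'M[bool]_n)
    (x : 'I_r -> 'I_n) (y : 'I_m -> 'I_n) :
  0 < s -> m.+1 ^ (s * (s + t)) < r ->
  (forall i i', i != i' -> [exists j, M (x i) (y j) != M (x i') (y j)]) ->
  exists ab : {ffun 'I_s -> 'I_r} * {ffun 'I_t -> 'I_m},
    is_copy A M ([ffun i => x (ab.1 i)], [ffun j => y (ab.2 j)]).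
Proof.
move=> s0 ltr distx.
pose pat i := [set j | M (x i) (y j)].
have pat_inj : injective pat.
  move=> i i' e; apply/eqP; apply: contraT => /distx/existsP[j].
  by move/setP/(_ j): e; rewrite !inE => ->; rewrite eqxx.
have ltF : #|'I_m|.+1 ^ (s * (s + t)) < #|pat @: setT|.
  by rewrite card_imset // cardsT !card_ord.
have [S shS ltS] := large_shattered ltF.
have shP (U : {set 'I_m}) : U \subset S ->
    exists i, forall j, j \in S -> M (x i) (y j) = (j \in U).
  move=> sU; have [_ /imsetP[i _ ->] e] := shattersP _ _ shS _ sU; exists i => j jS.
  by rewrite -e !inE jS andbT.
(* Shattering separates any two indices of [S], so they cannot be the same column of [M]. *)
have y_inj : {in S &, injective y}.
  move=> j j' jS j'S e; have [|i hi] := shP [set j]; first by rewrite sub1set.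
  have := hi _ j'S; rewrite -e hi // !inE eqxx => /esym/eqP-> //.
have /card_gt0P[j0 _] : 0 < #|S| by apply: leq_ltn_trans ltS.
(* The map [y] need not be increasing: the shattered indices are sorted by their position in [M]. *)
pose yn j := nat_of_ord (y j).
pose cols := sort (relpre yn leq) (enum S).
have cols_uniq : uniq cols by rewrite sort_uniq enum_uniq.
have mem_cols j : (j \in cols) = (j \in S) by rewrite mem_sort mem_enum.
have size_cols : s * (s + t) < size cols by rewrite size_sort -cardE.
have cols_sorted : sorted (relpre yn ltn) cols.
  rewrite -sorted_map ltn_sorted_uniq_leq.
  rewrite map_inj_in_uniq ?cols_uniq => [|i j iS jS /val_inj]; last first.
    by apply: y_inj; rewrite -mem_cols.
  by rewrite sorted_map; apply: sort_sorted => i j; exact: leq_total.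
pose idx (b : 'I_s) (j : 'I_(s + t)) := b * (s + t) + j.
have ltidx b j : idx b j < size cols.
  apply: leq_trans size_cols; rewrite /idx ltnS.
  apply: (@leq_trans (b * (s + t) + (s + t))); first by rewrite leq_add2l ltnW.
  by rewrite -mulSnr leq_mul2r ltn_ord orbT.
have idx_inj b b' j j' : idx b j = idx b' j' -> b = b' /\ j = j'.
  move=> e; have st0 : 0 < s + t by rewrite addn_gt0 s0.
  have := congr1 (modn^~ (s + t)) e; have := congr1 (divn^~ (s + t)) e.
  rewrite /idx !divnMDl // !modnMDl !modn_small // !divn_small // !addn0.
  by move=> /val_inj -> /val_inj ->.
pose col b j := nth j0 cols (idx b j).
have colS b j : col b j \in S by rewrite -mem_cols mem_nth.
have col_inj b b' j j' : col b j = col b' j' -> b = b' /\ j = j'.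
  by move/eqP; rewrite nth_uniq // => /eqP/idx_inj.
(* Label columns make the rows assigned to distinct labels distinct even when
   [A] has equal rows. *)
pose A' (i : 'I_s) (j : 'I_(s + t)) :=
  match split j with inl k => k == i | inr k => A i k end.
(* The row [w f] shows, in each block [b], the pattern of the label [f b]. *)
have [w wP] : exists w : {ffun 'I_s -> 'I_s} -> 'I_r,
    forall f b j, M (x (w f)) (y (col b j)) = A' (f b) j.
  have h (f : {ffun 'I_s -> 'I_s}) : exists i, forall b j, M (x i) (y (col b j)) = A' (f b) j.
    pose U := [set col p.1 p.2 | p : 'I_s * 'I_(s + t) & A' (f p.1) p.2].
    have [|i hi] := shP U; first by apply/subsetP => _ /imsetP[p _ ->].
    exists i => b j; rewrite hi //; apply/imsetP/idP => [[[b' j'] /=]|Aj].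
      by rewrite inE /= => Aj /col_inj[-> ->].
    by exists (b, j); rewrite ?inE.
  by have [w] := fin_all_exists h; exists w.
have w_inj : injective (fun f => nat_of_ord (x (w f))).
  move=> f f' /val_inj e; apply/ffunP => b.
  have := wP f' b (lshift t (f b)); rewrite -e wP /A'.
  by rewrite (unsplitK (inl _)) eqxx => /esym/eqP.
case es: (enum 'I_s) => [|v ss].
  by have := size_enum_ord s; rewrite es => e; rewrite -e in s0.
have us : uniq (v :: ss) by rewrite -es enum_uniq.
have ltss : size ss < #|[set: 'I_s]|.
  by have := size_enum_ord s; rewrite es cardsT card_ord /=; lia.
have [b _ [fs [mfs sfs _]]] := ordered_block w_inj [ffun=> v] us ltss.
rewrite -es in mfs.
have size_fs : size fs = s by rewrite -(size_map (fun f : {ffun _} => f b)) mfs size_enum_ord.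
pose f0 : {ffun 'I_s -> 'I_s} := [ffun=> v].
have fsb (i : 'I_s) : (nth f0 fs i) b = i.
  have := congr1 (fun q => nth v q i) mfs; rewrite nth_ord_enum (nth_map f0) //.
  by rewrite size_fs.
exists ([ffun i : 'I_s => w (nth f0 fs i)], [ffun j => col b (rshift s j)]).
apply/and3P; split.
- apply/forallP => i; apply/forallP => j; apply/implyP => ij; rewrite !ffunE /=.
  rewrite ?ffunE; apply: (sorted_ltn_nth _ f0 sfs) => //; rewrite ?inE ?size_fs //.
  by move=> ? ? ?; apply: ltn_trans.
- apply/forallP => i; apply/forallP => j; apply/implyP => ij; rewrite !ffunE /=.
  rewrite ?ffunE; apply: (sorted_ltn_nth _ j0 cols_sorted); rewrite ?inE //.
    by move=> ? ? ?; apply: ltn_trans.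
  by rewrite /idx /= !ltn_add2l.
apply/forallP => i; apply/forallP => j; rewrite !ffunE /= ?ffunE wP fsb /A'.
by rewrite (unsplitK (inr _)).
Qed.

(** * Union bound, sample sizes and sequential sampling *)

Lemma card_cover (I T : finType) (P : {pred I}) (F : I -> {set T}) (S : {set T}) :
  (forall x, x \in S -> exists2 i, i \in P & x \in F i) ->
  #|S| <= \sum_(i in P) #|F i|.
Proof.
move=> cov; have /subset_leq_card/leq_trans : S \subset \bigcup_(i in P) F i.
  by apply/subsetP => x /cov[i iP xF]; apply/bigcupP; exists i.
apply; elim/big_rec2: _ => [|i k B _ le]; first by rewrite cards0.
by apply: leq_trans (leq_card_setU _ _).1 _; rewrite leq_add2l.
Qed.

Lemma incr_inj k n (f : {ffun 'I_k -> 'I_n}) : incr f -> injective f.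
Proof.
move=> /forallP h i j e; apply/val_inj/eqP; rewrite eqn_leq.
have lt (i' j' : 'I_k) : i' < j' -> f i' < f j'.
  by move=> ij; have /forallP/(_ j')/implyP := h i'; apply.
by case: (ltngtP i j) => // /lt; rewrite e ltnn.
Qed.

(** For positive [a] this is [(1 + 1/a)^(a+1) >= 2], from Bernoulli's inequality
    [(1 + 1/b)^k >= 1 + k/b], proved as [h]. *)
Lemma expn_succ_double a : 2 * a ^ a.+1 <= a.+1 ^ a.+1.
Proof.
case: a => // a; set b := a.+1.
have h k : (b + k) * b ^ k <= b * b.+1 ^ k.
  elim: k => [|k IH]; first by rewrite addn0 !expn0.
  rewrite !expnS; apply: (@leq_trans (b.+1 * ((b + k) * b ^ k))); last by nia.
  by rewrite mulnA [X in _ <= X]mulnA leq_mul2r; apply/orP; right; nia.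
rewrite -(leq_pmul2l (ltn0Sn a : 0 < b)); apply: leq_trans (h b.+1); nia.
Qed.

(** Numbers of sampled columns and rows. The height is the least that [distinct_rows_copy] accepts
    for this width; the width is a multiple of [g], large enough for a union bound over pairs of
    rows. *)
Definition sample_width D g := g * (4 * D * (32 * D * g + 8)).
Definition sample_height D g := ((sample_width D g).+1 ^ D).+1.

(** With [e = m / g] one has [(1 - 1/g)^m <= 2^-e]. As [e = 4 D f] and [8(m+1) <= f^2 <= 2^(2f)],
    the number [2^e] is at least [(8(m+1))^(2D)], which dominates twice the squared height. *)
Lemma sample_sizes D g : 0 < g -> 0 < D ->
  2 * sample_height D g ^ 2 * g.-1 ^ sample_width D g <= g ^ sample_width D g.
Proof.
case: g => // a _ D0; rewrite /sample_height.
set m := sample_width D a.+1; set g := a.+1; pose f := 32 * D * g + 8; pose e := 4 * D * f.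
have em : m = g * e by [].
have f8 : 8 <= f by rewrite leq_addl.
have h1 : 2 ^ e * a ^ m <= g ^ m.
  have e0 : 0 < e by rewrite !muln_gt0 D0 (leq_trans _ f8).
  by rewrite em (expnM a) (expnM g) -expnMn leq_exp2r //; apply: expn_succ_double.
apply: leq_trans h1; rewrite leq_mul2r; apply/orP; right.
have f2 : 8 * m.+1 <= f * f.
  have h b : 8 <= b -> 8 * (g * (4 * D * b)).+1 <= (32 * D * g + 8) * b.
    by move: (g) => g' hb; rewrite mulnDl mulnS addnC; apply: leq_add; lia.
  by rewrite em; apply: h.
have h4 : f * f <= 2 ^ (2 * f).
  by rewrite mul2n -addnn expnD leq_mul // ltnW // ltn_expl.
have -> : e = 2 * f * (2 * D) by rewrite /e; lia.
rewrite expnM; apply: (@leq_trans ((8 * m.+1) ^ (2 * D))); last first.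
  by rewrite leq_exp2r ?muln_gt0 //; apply: leq_trans f2 h4.
rewrite expnMn; set w := m.+1 ^ D.
have -> : m.+1 ^ (2 * D) = w ^ 2 by rewrite -expnM mulnC.
have w1 : 0 < w by rewrite expn_gt0.
have : 8 <= 8 ^ (2 * D) by rewrite -{1}(expn1 8) leq_exp2l //; lia.
move: (8 ^ _) => q; nia.
Qed.

(* Each coordinate of [X u] is determined by, and determines, the matching
   coordinate of [u] once the previous ones are known. *)
Lemma card_sample_at (T T' : finType) r s (X : {ffun 'I_r -> T} -> 'I_r -> T')
    (a : 'I_s -> 'I_r) (p : 'I_s -> T') :
  (forall (u u' : {ffun 'I_r -> T}) (k : 'I_r),
     (forall j : 'I_r, j < k -> u j = u' j) -> X u k = X u' k -> u k = u' k) ->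
  injective a ->
  #|[set u | [forall i, X u (a i) == p i]]| * #|T| ^ s <= #|T| ^ r.
Proof.
move=> Xinj ainj; set P := [set u | _].
(* [mix] overwrites by [v] the coordinates of [u] in the range of [a]. It is injective on [P]: [v]
   is read off, and the lost coordinates of [u] are recovered in increasing order through [Xinj]. *)
pose mix (uv : {ffun 'I_r -> T} * {ffun 'I_s -> T}) : {ffun 'I_r -> T} :=
  [ffun k => if [pick i | a i == k] is Some i then uv.2 i else uv.1 k].
have <- : #|{ffun 'I_s -> T}| = #|T| ^ s by rewrite card_ffun card_ord.
have <- : #|{ffun 'I_r -> T}| = #|T| ^ r by rewrite card_ffun card_ord.
rewrite -[#|{ffun 'I_s -> T}|]cardsT -cardsX -(@card_in_imset _ _ mix) ?max_card //.
move=> [u v] [u' v']; rewrite !inE !andbT /= => /forallP Pu /forallP Pu' /ffunP e.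
have ev : v = v'.
  apply/ffunP => i; have := e (a i); rewrite !ffunE.
  by case: pickP => [i' /eqP/ainj ->|/(_ i)] //=; rewrite eqxx.
have eu k : (forall i, a i != k) -> u k = u' k.
  move=> nk; have := e k; rewrite !ffunE.
  by case: pickP => [i /eqP ik|] //=; have := nk i; rewrite ik eqxx.
rewrite ev; congr pair; apply/ffunP => k.
have [l] := ubnP (val k); elim: l k => // l IH k; rewrite ltnS => lkl.
have [/existsP[i /eqP ik]|] := boolP [exists i, a i == k]; last first.
  by rewrite negb_exists => /forallP/eu.
apply: Xinj => [j jk|]; last by rewrite -ik (eqP (Pu i)) (eqP (Pu' i)).
by apply: IH; apply: leq_trans jk lkl.
Qed.

(** * Far rows and the clustering dichotomy *)

Section RowClustering.
Variables (n g : nat) (M : 'M[bool]_n).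

Definition row_dist (x x' : 'I_n) := #|[set y | M x y != M x' y]|.

Definition far_from (Z : seq 'I_n) :=
  [set x | all (fun z => n < g * row_dist x z) Z].

Section FarProcess.
Variables (r G : nat) (x0 : 'I_n).
Hypothesis far_large : forall Z : seq 'I_n, size Z < r -> G <= #|far_from Z|.

Definition digit (u : {ffun 'I_r -> 'I_G}) k : nat :=
  if insub k is Some i then u i else 0.

(** Each new row is the far row whose rank is the next digit of [u]. Ranks restricted to ['I_G] give
    every step the same number of options, so samples form a plain function space. *)
Fixpoint far_seq (u : {ffun 'I_r -> 'I_G}) k : seq 'I_n :=
  if k is k'.+1 then
    rcons (far_seq u k') (nth x0 (enum (far_from (far_seq u k'))) (digit u k'))
  else [::].

Definition far_row u (k : 'I_r) : 'I_n :=
  nth x0 (enum (far_from (far_seq u k))) (digit u k).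

Lemma digitE u (k : 'I_r) : digit u k = u k.
Proof. by rewrite /digit insubT // => lk; congr (val (u _)); apply: val_inj. Qed.

Lemma size_far_seq u k : size (far_seq u k) = k.
Proof. by elim: k => //= k IH; rewrite size_rcons IH. Qed.

Lemma digit_lt u (k : 'I_r) : digit u k < size (enum (far_from (far_seq u k))).
Proof.
rewrite digitE -cardE; apply: leq_trans (ltn_ord _) _.
by apply: far_large; rewrite size_far_seq.
Qed.

Lemma far_row_mem u (j : 'I_r) k : j < k -> far_row u j \in far_seq u k.
Proof.
elim: k => //= k IH; rewrite ltnS leq_eqVlt mem_rcons inE => /predU1P[<-|/IH->].
  by rewrite /far_row eqxx.
by rewrite orbT.
Qed.

Lemma far_row_dist u (j k : 'I_r) : j < k ->
  n < g * row_dist (far_row u k) (far_row u j).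
Proof.
move=> jk; have : far_row u k \in far_from (far_seq u k).
  by rewrite -mem_enum mem_nth ?digit_lt.
by rewrite inE => /allP; apply; apply: far_row_mem.
Qed.

(** This is the hypothesis of [card_sample_at]: equal earlier choices give the same list of far
    rows, in which a row determines its rank. *)
Lemma far_row_inj (u u' : {ffun 'I_r -> 'I_G}) (k : 'I_r) :
  (forall j : 'I_r, j < k -> u j = u' j) -> far_row u k = far_row u' k -> u k = u' k.
Proof.
move=> agree; have e l : l <= k -> far_seq u l = far_seq u' l.
  elim: l => [//|l IH] lk.
  have ltlr : l < r by apply: leq_trans lk (ltnW (ltn_ord k)).
  have ed : digit u l = digit u' l.
    by have := agree (Ordinal ltlr) lk; rewrite /digit insubT => ->.
  by rewrite /= ed IH // ltnW.
have ltu := digit_lt u k; have ltu' := digit_lt u' k.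
rewrite /far_row -e // in ltu' *; move=> /eqP; rewrite nth_uniq ?enum_uniq //.
by rewrite !digitE => /eqP/val_inj.
Qed.

End FarProcess.

Lemma row_distC x x' : row_dist x x' = row_dist x' x.
Proof. by apply: eq_card => y; rewrite !inE eq_sym. Qed.

(** Each coordinate of [y] lies in the agreement set [E], of density less than [1 - 1/g]. *)
Lemma card_agreeing_columns m x x' : n < g * row_dist x x' ->
  #|[set y : {ffun 'I_m -> 'I_n} | [forall k, M x (y k) == M x' (y k)]]| * g ^ m
    <= g.-1 ^ m * n ^ m.
Proof.
move=> far; pose E := [set y | M x y == M x' y].
have -> : #|[set y : {ffun 'I_m -> 'I_n} | [forall k, M x (y k) == M x' (y k)]]| = #|E| ^ m.
  rewrite -[in RHS](card_ord m) -card_ffun_on; apply: eq_card => y; rewrite inE.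
  by apply/forallP/ffun_onP => h k; have := h k; rewrite inE.
have cE : #|E| + row_dist x x' = n.
  rewrite -[RHS]card_ord -cardsT -(cardsID E setT) setTI; congr (_ + _).
  by apply: eq_card => y; rewrite !inE andbT.
rewrite -!expnMn; case: m => // m; rewrite leq_exp2r //.
case: g far => // g' /=; move: cE; move: #|E| (row_dist x x') => e d.
by move: (n) => n' <-; nia.
Qed.

Lemma sampled_rows_separated m r (x : 'I_r -> 'I_n) :
  0 < r -> 0 < g -> 2 * r ^ 2 * g.-1 ^ m <= g ^ m ->
  (forall i i', i != i' -> n < g * row_dist (x i) (x i')) ->
  n ^ m <= 2 * #|[set y : {ffun 'I_m -> 'I_n} | [forall i, forall i', (i != i') ==>
                    [exists j, M (x i) (y j) != M (x i') (y j)]]]|.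
Proof.
move=> r0 g0 hm far; set S := [set y | _].
have cT : #|S| + #|~: S| = n ^ m by rewrite cardsC card_ffun !card_ord.
suff : 2 * #|~: S| <= n ^ m by lia.
pose F (p : 'I_r * 'I_r) :=
  [set y : {ffun 'I_m -> 'I_n} | [forall k, M (x p.1) (y k) == M (x p.2) (y k)]].
have : #|~: S| <= \sum_(p in [pred p | p.1 != p.2]) #|F p|.
  apply: card_cover => y; rewrite !inE negb_forall => /existsP[i].
  rewrite negb_forall => /existsP[i']; rewrite negb_imply negb_exists.
  move=> /andP[ii' /forallP h]; exists (i, i') => //.
  by rewrite inE; apply/forallP => k; have := h k; rewrite negbK.
have Fle p : p \in [pred p | p.1 != p.2] -> 2 * r ^ 2 * #|F p| <= n ^ m.
  rewrite inE => /far/(@card_agreeing_columns m) h.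
  rewrite -(leq_pmul2r (_ : 0 < g ^ m)) ?expn_gt0 ?g0 //.
  rewrite -mulnA; apply: leq_trans (leq_mul (leqnn _) h) _.
  by rewrite mulnA [X in _ <= X]mulnC leq_mul2r hm orbT.
move=> le; rewrite -(leq_pmul2l (_ : 0 < r ^ 2)) ?expn_gt0 ?r0 //.
apply: (@leq_trans (\sum_(p in [pred p : 'I_r * 'I_r | p.1 != p.2]) 2 * r ^ 2 * #|F p|)).
  by rewrite -big_distrr /= mulnA [r ^ 2 * 2]mulnC leq_mul2l le orbT.
apply: (@leq_trans (\sum_(p : 'I_r * 'I_r) n ^ m)); last first.
  by rewrite sum_nat_const card_prod card_ord.
by rewrite [X in _ <= X](bigID [pred p : 'I_r * 'I_r | p.1 != p.2]) /=;
  apply: leq_trans (leq_addr _ _); apply: leq_sum.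
Qed.

End RowClustering.

(** If no short list of centers works, each step of the far process has at least [G > n / g]
    choices. At least half of the pairs [(u, y)] are separating; each yields a copy with index
    tuples, and each such datum arises from few pairs. *)
Lemma row_clustering s t n g (A : 'M[bool]_(s, t)) (M : 'M[bool]_n) :
  0 < s -> 0 < g -> 0 < n ->
  let D := s * (s + t) in let m := sample_width D g in let r := sample_height D g in
  n ^ (s + t) <= 2 * (g * r) ^ s * m ^ t * num_copies A M \/
  exists2 Z : seq 'I_n, size Z < r & g * #|far_from g M Z| <= n.
Proof.
move=> s0 g0 n0 D m r.
(* Lists of fewer than [r] rows are encoded in a finite type, so the alternative is decidable. *)
have [/existsP[Z hZ]|/existsPn nZ] :=
  boolP [exists Z : {i : 'I_r & i.-tuple 'I_n}, g * #|far_from g M (tagged Z)| <= n].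
  by right; exists (tagged Z) => //; rewrite size_tuple.
left; pose G := (n %/ g).+1; have x0 : 'I_n := Ordinal n0.
have far_large (Z : seq 'I_n) : size Z < r -> G <= #|far_from g M Z|.
  move=> ltZ; have := nZ (Tagged (fun i : 'I_r => i.-tuple 'I_n)
                            (in_tuple Z : (Ordinal ltZ).-tuple 'I_n)).
  by rewrite -ltnNge /= mulnC -ltn_divLR.
pose X u := @far_row n g M r G x0 u.
have D0 : 0 < D by rewrite muln_gt0 s0 addn_gt0 s0.
pose sep u (y : {ffun 'I_m -> 'I_n}) := [forall i, forall i', (i != i') ==>
                    [exists j, M (X u i) (y j) != M (X u i') (y j)]].
have many u : n ^ m <= 2 * #|[set y | sep u y]|.
  apply: (@sampled_rows_separated n g) => //; first exact: sample_sizes.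
  move=> i i'; case: (ltngtP i i') => [lt|lt|/val_inj->]; last by rewrite eqxx.
    by move=> _; rewrite row_distC; apply: far_row_dist.
  by move=> _; apply: far_row_dist.
pose S := [set uy : {ffun 'I_r -> 'I_G} * {ffun 'I_m -> 'I_n} | sep uy.1 uy.2].
have cS : G ^ r * n ^ m <= 2 * #|S|.
  have -> : #|S| = \sum_(u : {ffun 'I_r -> 'I_G}) #|[set y | sep u y]|.
    rewrite -sum1_card (eq_bigl (fun uy => true && sep uy.1 uy.2)) => [|uy]; last by rewrite inE.
    rewrite -(pair_big_dep xpredT sep (fun _ _ => 1)) /=; apply: eq_bigr => u _.
    by rewrite sum1_card; apply: eq_card => y; rewrite !inE.
  rewrite big_distrr /=; apply: (@leq_trans (\sum_(u : {ffun 'I_r -> 'I_G}) n ^ m)).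
    by rewrite sum_nat_const card_ffun !card_ord.
  by apply: leq_sum => u _; apply: many.
pose idx := (({ffun 'I_s -> 'I_r} * {ffun 'I_t -> 'I_m}) * loc s t n)%type.
pose F (q : idx) := [set uy : {ffun 'I_r -> 'I_G} * {ffun 'I_m -> 'I_n} |
  [forall i, X uy.1 (q.1.1 i) == q.2.1 i] && [forall j, uy.2 (q.1.2 j) == q.2.2 j]].
have cov : #|S| <= \sum_(q in [pred q : idx | is_copy A M q.2]) #|F q|.
  apply: card_cover => -[u y]; rewrite inE /= => /forallP sepuy.
  have [|[a b] ab] := @distinct_rows_copy s t n m r A M (X u) y s0 (leqnn _).
    by move=> i i' ii'; have /forallP/(_ i')/implyP/(_ ii') := sepuy i.
  exists ((a, b), ([ffun i => X u (a i)], [ffun j => y (b j)])) => //.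
  by rewrite inE /=; apply/andP; split; apply/forallP => i; rewrite ffunE.
(* A copy at prescribed indices constrains [s] row choices and [t] columns, leaving at most a
   fraction [1 / (G^s n^t)] of all pairs. *)
have Fle q : q \in [pred q : idx | is_copy A M q.2] -> #|F q| * (G ^ s * n ^ t) <= G ^ r * n ^ m.
  case: q => -[a b] [p q]; rewrite inE /= => /and3P[/= ip iq _].
  have [->|[[u y]]] := set_0Vmem (F (a, b, (p, q))); first by rewrite cards0.
  rewrite inE /= => /andP[/forallP ha /forallP hb].
  have ainj : injective a.
    by move=> i i' e; apply: (incr_inj ip); rewrite -(eqP (ha i)) e (eqP (ha i')).
  have binj : injective b.
    by move=> i i' e; apply: (incr_inj iq); rewrite -(eqP (hb i)) e (eqP (hb i')).
  have := @card_sample_at _ _ r s X a p (@far_row_inj _ _ _ _ _ x0 far_large) ainj.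
  have := @card_sample_at _ _ m t (fun y => y : 'I_m -> 'I_n) b q (fun _ _ _ _ e => e) binj.
  rewrite !card_ord; set P := [set _ | _]; set P' := [set _ | _] => h h'.
  have -> : F (a, b, (p, q)) = setX P' P by apply/setP => -[u' y']; rewrite !inE.
  by rewrite cardsX mulnACA leq_mul.
have G0 : 0 < G by [].
have Gs : G ^ s * n ^ t <= 2 * r ^ s * m ^ t * num_copies A M.
  rewrite -(leq_pmul2l (_ : 0 < G ^ r * n ^ m)) ?muln_gt0 ?expn_gt0 ?n0 //.
  apply: leq_trans (leq_mul cS (leqnn _)) _.
  have : #|S| * (G ^ s * n ^ t) <= (r ^ s * m ^ t * num_copies A M) * (G ^ r * n ^ m).
    apply: leq_trans (leq_mul cov (leqnn _)) _; rewrite big_distrl /=.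
    apply: (@leq_trans (\sum_(q in [pred q : idx | is_copy A M q.2]) G ^ r * n ^ m)).
      by apply: leq_sum => q; apply: Fle.
    rewrite sum_nat_const leq_mul2r; apply/orP; right.
    have -> : #|[pred q : idx | is_copy A M q.2]| =
        #|setX [set: {ffun 'I_s -> 'I_r} * {ffun 'I_t -> 'I_m}]
              [set c | is_copy A M c]|.
      by apply: eq_card => -[ab c]; rewrite !inE.
    by rewrite cardsX cardsT card_prod !card_ffun !card_ord.
  by move: (G ^ s * n ^ t) => w; nia.
have nG : n <= g * G by rewrite mulnC ltnW // -ltn_divLR.
rewrite expnD; apply: (@leq_trans (g ^ s * (G ^ s * n ^ t))).
  by rewrite mulnA -expnMn leq_mul2r leq_exp2r // nG orbT.
apply: leq_trans (leq_mul (leqnn _) Gs) _.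
by rewrite expnMn; apply: eq_leq; lia.
Qed.

(** * Quantile boxes and copies inside products *)

Lemma quantile (T : finType) (S : {set T}) n (u : T -> 'I_n) k : k < #|S| ->
  exists v : nat, #|[set c in S | u c < v]| <= k < #|[set c in S | u c <= v]|.
Proof.
move=> ltk; have ex : exists v, k < #|[set c in S | u c <= v]|.
  exists n; rewrite (_ : [set _ in S | _] = S) //.
  by apply/setP => c; rewrite inE (ltnW (ltn_ord _)) andbT.
case: (ex_minnP ex) => v ltv minv; exists v; rewrite ltv andbT.
case: v ltv minv => [|v] _ minv.
  by rewrite (_ : [set _ in S | _] = set0) ?cards0 //; apply/setP => c; rewrite !inE andbF.
by rewrite leqNgt; apply/negP => /minv; rewrite ltnn.
Qed.

(** [Y j] holds the values of [u j] between its quantiles of ranks [j * K] and [j.+1 * K]. More than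
    [K] elements land there, at most [m] per value. Since [u i < u j] pointwise, the top of band [i]
    is strictly below the bottom of band [j]. *)
Lemma increasing_boxes (T : finType) (S : {set T}) n t (u : 'I_t -> T -> 'I_n) m K :
  (forall c, c \in S -> forall i j : 'I_t, i < j -> u i c < u j c) ->
  (forall j v, #|[set c in S | u j c == v]| <= m) -> t * K < #|S| ->
  exists Y : 'I_t -> {set 'I_n},
  [/\ forall j, K < m * #|Y j|,
      forall j v, v \in Y j -> exists2 c, c \in S & u j c = v
    & forall (i j : 'I_t) v w, i < j -> v \in Y i -> w \in Y j -> v < w].
Proof.
move=> uinc mult ltS.
have [al alP] := fin_all_exists (fun j : 'I_t => @quantile T S n (u j) (j * K)
  (leq_ltn_trans (leq_mul (ltnW (ltn_ord j)) (leqnn K)) ltS)).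
have [be beP] := fin_all_exists (fun j : 'I_t => @quantile T S n (u j) (j.+1 * K)
  (leq_ltn_trans (leq_mul (ltn_ord j) (leqnn K)) ltS)).
pose W j := [set c in S | al j <= u j c <= be j].
exists (fun j => u j @: W j); split.
- move=> j; have /andP[leal _] := alP j; have /andP[_ ltbe] := beP j.
  have leW : #|W j| <= #|u j @: W j| * m.
    rewrite -sum_nat_const.
    apply: leq_trans (_ : _ <= \sum_(v in u j @: W j) #|[set c in S | u j c == v]|) _.
      apply: card_cover => c cW; exists (u j c); first exact: imset_f.
      by move: cW; rewrite !inE => /andP[-> _] /=.
    by apply: leq_sum => v _; apply: mult.
  have : #|[set c in S | u j c <= be j]| <= #|[set c in S | u j c < al j]| + #|W j|.
    apply: leq_trans (leq_card_setU _ _).1; apply/subset_leq_card/subsetP => c.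
    by rewrite !inE => /andP[-> ->]; rewrite andbT /=; case: ltnP.
  move=> le; rewrite mulnC; apply: leq_trans leW; rewrite -(ltn_add2l (j * K)) -mulSnr.
  by apply: leq_trans ltbe _; apply: leq_trans le _; rewrite leq_add2r.
- by move=> j v /imsetP[c]; rewrite inE => /andP[cS _] ->; exists c.
move=> i j v w ij /imsetP[c]; rewrite inE => /and3P[cS _ lec] ->.
move=> /imsetP[d]; rewrite inE => /and3P[dS led _] ->.
apply: leq_ltn_trans lec _; apply: leq_trans led; rewrite ltnNge; apply/negP => leab.
have /andP[_ h1] := alP j; have /andP[h2 _] := beP i.
suff : #|[set c in S | u j c <= al j]| <= #|[set c in S | u i c < be i]|.
  have : i.+1 * K <= j * K by rewrite leq_mul2r ij orbT.
  by lia.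
apply/subset_leq_card/subsetP => e; rewrite !inE => /andP[eS le]; rewrite eS /=.
by apply: leq_trans (uinc _ eS _ _ ij) _; apply: leq_trans le _.
Qed.

Lemma card_familyE (I T : finType) (X : I -> {set T}) :
  #|[set f : {ffun I -> T} | f \in family X]| = \prod_i #|X i|.
Proof.
rewrite cardsE (card_family (fun i => mem (X i))) foldrE big_map big_enum /=.
by apply: eq_bigr => i _; apply: eq_card.
Qed.

(** For fixed columns, random rows are wrong at a given entry with probability at most
    [1 / (2 s t)], hence right everywhere with probability at least one half. *)
Lemma box_copies s t n (A : 'M[bool]_(s, t)) (M : 'M[bool]_n)
    (X : 'I_s -> {set 'I_n}) (Y : 'I_t -> {set 'I_n}) :
  (forall (i j : 'I_s) v w, i < j -> v \in X i -> w \in X j -> v < w) ->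
  (forall (i j : 'I_t) v w, i < j -> v \in Y i -> w \in Y j -> v < w) ->
  (forall i j y, y \in Y j -> 2 * (s * t) * #|[set x in X i | M x y != A i j]| <= #|X i|) ->
  0 < s * t ->
  (\prod_i #|X i|) * (\prod_j #|Y j|) <= 2 * num_copies A M.
Proof.
move=> Xinc Yinc err st0.
rewrite -!card_familyE; set FX := [set f | _]; set FY := [set f | _].
pose ok (x : {ffun 'I_s -> 'I_n}) (y : {ffun 'I_t -> 'I_n}) :=
  [forall i, forall j, M (x i) (y j) == A i j].
have okX y : y \in FY -> #|FX| <= 2 * #|[set x in FX | ok x y]|.
  rewrite inE => /familyP yY.
  pose bad (p : 'I_s * 'I_t) := [set x in FX | M (x p.1) (y p.2) != A p.1 p.2].
  have le p : 2 * (s * t) * #|bad p| <= #|FX|.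
    case: p => i j; pose X' k := if k == i then [set x in X i | M x (y j) != A i j] else X k.
    have -> : bad (i, j) = [set f | f \in family X'].
      apply/setP => x; rewrite !inE; apply/andP/familyP => [[/familyP xX ne] k | xX'].
        by rewrite /X'; case: eqP => [->|_]; rewrite ?inE ?xX ?ne.
      have := xX' i; rewrite /X' eqxx inE => /andP[xi ne]; split=> //.
      by apply/familyP => k; have := xX' k; rewrite /X'; case: eqP => [->|_].
    rewrite !card_familyE (bigD1 i) //= [X in _ <= X](bigD1 i) //= mulnA leq_mul //.
      by rewrite /X' eqxx err // yY.
    by apply: eq_leq; apply: eq_bigr => k /negPf ne; rewrite /X' ne.
  have : #|FX :\: [set x in FX | ok x y]| <= \sum_(p in [set: 'I_s * 'I_t]) #|bad p|.
    apply: card_cover => x; rewrite !inE => /andP[+ xF]; rewrite xF /= negb_forall.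
    move=> /existsP[i]; rewrite negb_forall => /existsP[j ne].
    by exists (i, j); rewrite ?inE // xF.
  have : 2 * (s * t) * \sum_(p in [set: 'I_s * 'I_t]) #|bad p| <= (s * t) * #|FX|.
    rewrite big_distrr /=; apply: (@leq_trans (\sum_(p in [set: 'I_s * 'I_t]) #|FX|)).
      by apply: leq_sum => p _; apply: le.
    by rewrite sum_nat_const cardsT card_prod !card_ord.
  have := cardsID [set x in FX | ok x y] FX.
  rewrite (_ : FX :&: _ = [set x in FX | ok x y]); last by apply/setP => x; rewrite !inE andbA andbb.
  move: (\sum_(_ in _) _) (#|FX|) (#|_|) (#|_|) => a b c d; nia.
have : #|FX| * #|FY| <= 2 * \sum_(y in FY) #|[set x in FX | ok x y]|.
  by rewrite mulnC -sum_nat_const big_distrr /=; apply: leq_sum.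
move/leq_trans; apply; rewrite leq_mul2l /=.
have -> : \sum_(y in FY) #|[set x in FX | ok x y]| =
    #|[set c : loc s t n | (c.1 \in FX) && ((c.2 \in FY) && ok c.1 c.2)]|.
  rewrite (eq_bigr (fun y => \sum_(x | (x \in FX) && ok x y) 1)) => [|y _]; last first.
    by rewrite -sum1_card; apply: eq_bigl => x; rewrite !inE.
  rewrite (exchange_big_dep (mem FX)) => [|y x _ /andP[]//] /=.
  rewrite (eq_bigr (fun x => \sum_(y | (y \in FY) && ok x y) 1)) => [|x xF]; last first.
    by apply: eq_bigl => y; rewrite xF.
  by rewrite pair_big_dep -[RHS]sum1_card; apply: eq_bigl => c; rewrite !inE.
apply/subset_leq_card/subsetP => -[x y]; rewrite !inE /=.
move=> /and3P[/familyP xX /familyP yY okxy]; apply/and3P; split => //=.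
  by apply/forallP => i; apply/forallP => j; apply/implyP => ij; apply: (Xinc i j).
by apply/forallP => i; apply/forallP => j; apply/implyP => ij; apply: (Yinc i j).
Qed.

(** * Counting along fibers and in short windows *)

Lemma card_fibers (T U : finType) (f : T -> U) (S : {set T}) :
  #|S| = \sum_u #|[set x in S | f x == u]|.
Proof.
rewrite -sum1_card (partition_big f xpredT) //=; apply: eq_bigr => u _.
by rewrite -sum1_card; apply: eq_bigl => x; rewrite !inE.
Qed.

Lemma leq_card_fibers (T U : finType) (f : T -> U) (P E : {set T}) a b :
  (forall u, a * #|[set x in P | f x == u]| <= b * #|[set x in E | f x == u]|) ->
  a * #|P| <= b * #|E|.
Proof.
by move=> h; rewrite (card_fibers f P) (card_fibers f E) !big_distrr; apply: leq_sum.
Qed.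

Lemma card_small_fibers (T U : finType) (f : T -> U) a n :
  a * #|[set x | a * #|[set x' | f x' == f x]| < n]| <= #|U| * n.
Proof.
set P := [set x | _]; rewrite (card_fibers f P) big_distrr /=.
apply: (@leq_trans (\sum_(u : U) n)); last by rewrite sum_nat_const.
apply: leq_sum => u _; have [->|[x]] := set_0Vmem [set x in P | f x == u].
  by rewrite cards0 muln0.
rewrite !inE => /andP[/ltnW lex /eqP <-]; apply: leq_trans lex.
by rewrite leq_mul2l subset_leq_card ?orbT //; apply/subsetP => x'; rewrite !inE => /andP[].
Qed.

(** [S] lies in a window of [n.-1 %/ b + 1] consecutive rows starting at its minimum. *)
Lemma card_clustered n (S : {set 'I_n}) b : 0 < n -> 0 < b ->
  (forall x x', x \in S -> x' \in S -> (x - x') * b < n) -> b * #|S| <= n + b.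
Proof.
move=> n0 b0 clust; have [->|[x0 x0S]] := set_0Vmem S; first by rewrite cards0 muln0.
case: (@arg_minnP _ x0 (mem S) val x0S) => x1 x1S min1.
pose w := n.-1 %/ b.
have leS : #|S| <= w.+1.
  rewrite -[w.+1]card_ord -(@card_in_imset _ _ (fun x : 'I_n => inord (x - x1) : 'I_w.+1)).
    exact: max_card.
  have lt x : x \in S -> x - x1 < w.+1.
    by move=> xS; rewrite ltnS leq_divRL //; have := clust _ _ xS x1S; lia.
  move=> x x' xS x'S /(congr1 val); rewrite /= !inordK ?lt // => e.
  have := min1 _ xS; have := min1 _ x'S; move=> /= h h'; apply: val_inj => /=; lia.
apply: (@leq_trans (b * w.+1)); first by rewrite leq_mul2l leS orbT.
by rewrite mulnS addnC leq_add2r mulnC; apply: leq_trans (leq_trunc_div _ _) (leq_pred _).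
Qed.

(** * Nested intervals of rows and the cells they cut out of clusters *)

Section Cells.
Variables (n r B : nat) (cl : 'I_n -> 'I_r).
Hypotheses (n_gt0 : 0 < n) (B_gt0 : 0 < B).
Implicit Types (k : nat) (x : 'I_n).

Definition slab k x := (x * B ^ k) %/ n.

Lemma slab_lt k x : slab k x < B ^ k.
Proof. by rewrite ltn_divLR // mulnC ltn_pmul2l ?expn_gt0 ?B_gt0. Qed.

Lemma slab_leq k (x x' : 'I_n) : x <= x' -> slab k x <= slab k x'.
Proof. by move=> le; rewrite leq_div2r // leq_mul2r le orbT. Qed.

Lemma slab_nested k k' x : k <= k' -> slab k x = slab k' x %/ B ^ (k' - k).
Proof.
move=> le; rewrite /slab -divnMA -{1}(subnK le) expnD mulnA mulnAC divnMr //.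
by rewrite expn_gt0 B_gt0.
Qed.

Lemma card_slab k j : B ^ k <= n -> B ^ k * #|[set x | slab k x == j]| <= 2 * n.
Proof.
move=> le; apply: (@leq_trans (n + B ^ k)); last by rewrite mul2n -addnn leq_add2l.
apply: card_clustered => //; first by rewrite expn_gt0 B_gt0.
move=> x x'; rewrite !inE => /eqP h /eqP h'; rewrite mulnBl.
have := ltn_ceil (x * B ^ k) n_gt0; have := leq_trunc_div (x' * B ^ k) n.
by rewrite -/(slab _ _) -/(slab _ _) h h' mulSn; lia.
Qed.

Definition cell k x := [set x' | (cl x' == cl x) && (slab k x' == slab k x)].

Definition low_cell k x := [set x' in cell k x | slab k.+1 x' < slab k.+1 x].

(** Cells are the fibers of this map into a finite type, which lets counts run cell by cell. *)
Definition cell_index k x : 'I_r * 'I_(B ^ k) := (cl x, Ordinal (slab_lt k x)).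

Lemma cell_indexE k x x' : (cell_index k x' == cell_index k x) = (x' \in cell k x).
Proof. by rewrite xpair_eqE inE -val_eqE. Qed.

Lemma card_thin_rows k l : 0 < r ->
  l * #|[set x | l * r * B ^ k * #|cell k x| < n]| <= n.
Proof.
move=> r0; set S := [set x | _].
have : l * r * B ^ k * #|S| <= #|{: 'I_r * 'I_(B ^ k)}| * n.
  apply: leq_trans (card_small_fibers (cell_index k) (l * r * B ^ k) n); rewrite leq_mul2l.
  apply/orP; right; apply/subset_leq_card/subsetP => x; rewrite !inE.
  suff -> : [set x' | cell_index k x' == cell_index k x] = cell k x by [].
  by apply/setP => x'; rewrite inE cell_indexE.
rewrite card_prod !card_ord.
rewrite (_ : l * r * B ^ k * #|S| = r * B ^ k * (l * #|S|)); last by lia.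
rewrite leq_pmul2l //.
by rewrite muln_gt0 r0 expn_gt0 B_gt0.
Qed.

(** In one thick cell, let [x] be a counted row of highest level-[k.+1] interval. Every counted row
    is in the low part of [x] or shares its interval; each of these holds at most a fraction [1/l]
    of the cell, the latter by the choice of [B]. *)
Lemma card_bottom_rows k l : B = 2 * l ^ 2 * r -> B ^ k.+1 <= n ->
  l * #|[set x | (n <= l * r * B ^ k * #|cell k x|) && (l * #|low_cell k x| < #|cell k x|)]|
    <= 2 * n.
Proof.
move=> defB leBn; rewrite -[X in _ <= 2 * X]card_ord -cardsT.
apply: (leq_card_fibers (f := cell_index k)) => u; set P := [set x in _ | _].
have [->|[x0 x0P]] := set_0Vmem P; first by rewrite cards0 muln0.
case: (@arg_maxnP _ x0 (mem P) (slab k.+1) x0P) => x /= xP maxx.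
have xu : cell_index k x = u by move: xP; rewrite inE => /andP[_ /eqP].
have -> : [set x in [set: 'I_n] | cell_index k x == u] = cell k x.
  by apply/setP => x'; rewrite !inE -xu cell_indexE inE.
have [thick low] : n <= l * r * B ^ k * #|cell k x| /\ l * #|low_cell k x| < #|cell k x|.
  by move: xP; rewrite !inE => /andP[/andP[]].
pose E := [set x' | slab k.+1 x' == slab k.+1 x].
have leP : #|P| <= #|low_cell k x| + #|E|.
  apply: leq_trans (leq_card_setU _ _).1; apply/subset_leq_card/subsetP => x' x'P.
  have := maxx _ x'P; rewrite leq_eqVlt => /predU1P[e|lt].
    by rewrite inE [x' \in E]inE e eqxx orbT.
  move: x'P; rewrite !inE => /andP[_]; rewrite -xu cell_indexE inE lt => ->.
  by [].
have leE : l * #|E| <= #|cell k x|.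
  have lr0 : 0 < 2 * l * r * B ^ k.
    have : 0 < l * r by move: B_gt0; rewrite defB -mulnn; case: (l) (r) => [|?] [|?]; rewrite ?muln0.
    by rewrite !muln_gt0 expn_gt0 B_gt0 => /andP[-> ->].
  rewrite -(leq_pmul2l lr0).
  have := leq_trans (card_slab (slab k.+1 x) leBn) (leq_mul (leqnn 2) thick).
  rewrite -/E expnS {1}defB.
  move: (B ^ k) #|E| #|cell k x| => b e c h.
  apply: leq_trans (_ : 2 * l ^ 2 * r * b * e <= _).
    by rewrite expnS expn1; lia.
  by apply: leq_trans h _; lia.
rewrite mul2n -addnn; apply: leq_trans (leq_mul (leqnn l) leP) _.
by rewrite mulnDr leq_add // ltnW.
Qed.

(** Markov's inequality on each cell and column: a block whose error fraction exceeds [1/h] is paid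
    for by [h] times its errors. *)
Lemma card_bad_blocks k h (M : 'M[bool]_n) (z : 'I_r -> 'I_n) :
  #|[set p : 'I_n * 'I_n | #|cell k p.1| <
      h * #|[set x in cell k p.1 | M x p.2 != M (z (cl p.1)) p.2]|]|
  <= h * #|[set p : 'I_n * 'I_n | M p.1 p.2 != M (z (cl p.1)) p.2]|.
Proof.
rewrite -[X in X <= _]mul1n.
apply: (leq_card_fibers (f := fun p => (cell_index k p.1, p.2))) => -[u y].
set P := [set p in _ | _]; rewrite mul1n.
have [->|[[x y'] ]] := set_0Vmem P; first by rewrite cards0.
rewrite !inE xpair_eqE /= => /andP[bad /andP[/eqP xu /eqP yy']]; rewrite {y'}yy' in bad.
apply: (@leq_trans #|setX (cell k x) [set y]|).
  apply/subset_leq_card/subsetP => -[x' y']; rewrite !inE xpair_eqE /= => /andP[_].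
  by rewrite -xu cell_indexE inE.
rewrite cardsX cards1 muln1; apply: leq_trans (ltnW bad) _.
rewrite leq_mul2l; apply/orP; right.
rewrite -[X in X <= _]muln1 -(cards1 y) -cardsX; apply/subset_leq_card/subsetP => -[x' y'].
rewrite !inE xpair_eqE /= => /andP[/andP[/andP[c1 c2] ne] /eqP ->].
by rewrite (eqP c1) ne -xu cell_indexE inE c1 c2 eqxx.
Qed.

End Cells.

(** * The clustered case *)

Lemma cluster_centers n g r (M : 'M[bool]_n) (Z : seq 'I_n) :
  0 < n -> size Z < r -> g * #|far_from g M Z| <= n ->
  exists (cl : 'I_n -> 'I_r) (z : 'I_r -> 'I_n),
    g * #|[set p : 'I_n * 'I_n | M p.1 p.2 != M (z (cl p.1)) p.2]| <= 2 * n ^ 2.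
Proof.
move=> n0 ltZ few; pose near x z := g * row_dist M x z <= n.
(* A row with no near center gets the index [size Z], allowed since [size Z < r], and a default
   center. There are at most [n / g] such rows, so they may err everywhere. *)
pose cl x := Ordinal (leq_ltn_trans (find_size (near x) Z) ltZ).
pose z (i : 'I_r) := nth (Ordinal n0) Z i.
exists cl, z; have -> : #|[set p : 'I_n * 'I_n | M p.1 p.2 != M (z (cl p.1)) p.2]| =
    \sum_x row_dist M x (z (cl x)).
  rewrite -sum1_card (eq_bigl (fun p => true && (M p.1 p.2 != M (z (cl p.1)) p.2))) => [|p];
    last by rewrite inE.
  rewrite -(pair_big_dep xpredT (fun x y => M x y != M (z (cl x)) y) (fun _ _ => 1)) /=.
  by apply: eq_bigr => x _; rewrite sum1_card /row_dist cardsE.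
rewrite big_distrr /= (bigID (mem (far_from g M Z))) /= mul2n -addnn; apply: leq_add.
  apply: (@leq_trans (\sum_(x in far_from g M Z) g * n)).
    apply: leq_sum => x _; rewrite leq_mul2l -[X in _ <= X]card_ord max_card orbT //.
  by rewrite sum_nat_const -mulnn mulnA leq_mul2r mulnC few orbT.
apply: (@leq_trans (\sum_(x : 'I_n) n)); last by rewrite sum_nat_const card_ord mulnn.
rewrite [X in _ <= X](bigID (mem (far_from g M Z))) /=; apply: leq_trans (leq_addl _ _).
apply: leq_sum => x; rewrite inE -has_predC => hasx.
suff : near x (z (cl x)) by [].
apply: nth_find; apply: sub_has hasx => w /=.
by rewrite -leqNgt.
Qed.

(** By disjointness, a copy in [C] is determined by the position of its entry [(i, j)]. *)
Lemma card_copies_through s t n (A : 'M[bool]_(s, t)) (M : 'M[bool]_n)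
    (C : {set loc s t n}) i j (P : {set 'I_n * 'I_n}) :
  disjoint_copies A M C -> #|[set c in C | (c.1 i, c.2 j) \in P]| <= #|P|.
Proof.
move=> [_ dis]; rewrite -(@card_in_imset _ _ (fun c : loc s t n => (c.1 i, c.2 j))).
  by apply/subset_leq_card/subsetP => x /imsetP[c cP ->]; move: cP; rewrite inE => /andP[].
move=> c d; rewrite !inE => /andP[cC _] /andP[dC _] e; apply/eqP; apply: contraT => ne.
have /pred0P/(_ (c.1 i, c.2 j)) := dis c d cC dC ne.
by rewrite /= {2}e !imset2_f.
Qed.

Lemma pigeonhole (T U : finType) (f : T -> U) (S : {set T}) : 0 < #|S| ->
  exists u, #|S| <= #|U| * #|[set x in S | f x == u]|.
Proof.
move=> /card_gt0P[x xS].
case: (@arg_maxnP _ (f x) xpredT (fun u => #|[set x in S | f x == u]|) isT) => u _ maxu.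
exists u; rewrite (card_fibers f S) -sum_nat_const.
by apply: leq_sum => v _; apply: maxu.
Qed.

(** [l] and [g] make each exceptional family [K1], [K2] at most [n^2 / (4Q)], so at least
    [n^2 / (2Q)] copies survive. The choice of [h] turns an error fraction [1/h] on a cell into
    [1 / (2 s t)] on a part of relative size at least [1/l], as [box_copies] requires. *)
Lemma copies_from_clusters s t n Q l h g r B (A : 'M[bool]_(s, t)) (M : 'M[bool]_n)
    (C : {set loc s t n}) (cl : 'I_n -> 'I_r) (z : 'I_r -> 'I_n) :
  0 < s -> 0 < t -> 0 < n -> 0 < Q ->
  l = 12 * s * Q -> h = 2 * (s * t) * l -> g = 16 * (s * t) * h * Q ->
  B = 2 * l ^ 2 * r -> B ^ s <= n ->
  disjoint_copies A M C -> n ^ 2 <= Q * #|C| ->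
  g * #|[set p : 'I_n * 'I_n | M p.1 p.2 != M (z (cl p.1)) p.2]| <= 2 * n ^ 2 ->
  n ^ (s + t) <=
    2 * (l ^ 2 * r * B ^ s) ^ s * (2 * Q * (r * B ^ s) ^ s * t) ^ t * num_copies A M.
Proof.
move=> s0 t0 n0 Q0 defl defh defg defB leBn disC manyC fewErr.
have r0 : 0 < r by case: (r) (cl (Ordinal n0)) => [[]|].
have l0 : 0 < l by rewrite defl !muln_gt0 s0 Q0.
have st0 : 0 < s * t by rewrite muln_gt0 s0 t0.
have h0 : 0 < h by rewrite defh !muln_gt0 s0 t0.
have B0 : 0 < B by rewrite defB -mulnn !muln_gt0 l0 r0.
pose i0 := Ordinal s0; pose j0 := Ordinal t0.
set Err := [set p | _] in fewErr.
pose thin k := [set x | l * r * B ^ k * #|cell B cl k x| < n].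
pose bottom k := [set x | (n <= l * r * B ^ k * #|cell B cl k x|) &&
                          (l * #|low_cell B cl k x| < #|cell B cl k x|)].
pose bad k := [set p : 'I_n * 'I_n | #|cell B cl k p.1| <
   h * #|[set x in cell B cl k p.1 | M x p.2 != M (z (cl p.1)) p.2]|].
pose K1 := [set c in C | [exists i : 'I_s, c.1 i \in thin i :|: bottom i]].
pose K2 := [set c in C | [exists i : 'I_s, exists j, (c.1 i, c.2 j) \in Err :|: bad i]].
have leK1 : 4 * Q * #|K1| <= n ^ 2.
  have le (i : 'I_s) : l * #|[set c in C | c.1 i \in thin i :|: bottom i]| <= 3 * n ^ 2.
    have := card_copies_through i j0 (setX (thin i :|: bottom i) setT) disC.
    rewrite cardsX cardsT card_ord.
    have -> : [set c in C | (c.1 i, c.2 j0) \in setX (thin i :|: bottom i) setT] =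
              [set c in C | c.1 i \in thin i :|: bottom i].
      by apply/setP => c; rewrite !inE /= andbT.
    move=> /(leq_mul (leqnn l)) /leq_trans; apply.
    rewrite mulnA -mulnn [X in _ <= X]mulnA leq_mul2r; apply/orP; right.
    apply: leq_trans (leq_mul (leqnn l) (leq_card_setU _ _).1) _.
    have := @card_thin_rows n r B cl n0 B0 i l r0.
    have := @card_bottom_rows n r B cl n0 B0 i l defB.
    have -> : B ^ i.+1 <= n by apply: leq_trans leBn; rewrite leq_pexp2l.
    by move=> /(_ isT) b1 b2; rewrite mulnDr addnC -(addn1 2) mulnDl mul1n leq_add.
  have cov : #|K1| <= \sum_(i in [set: 'I_s]) #|[set c in C | c.1 i \in thin i :|: bottom i]|.
    apply: card_cover => c; rewrite inE => /andP[cC /existsP[i hi]].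
    by exists i; [rewrite inE | rewrite inE cC].
  have : l * #|K1| <= s * (3 * n ^ 2).
    apply: leq_trans (leq_mul (leqnn l) cov) _; rewrite big_distrr /=.
    apply: (@leq_trans (\sum_(i in [set: 'I_s]) 3 * n ^ 2)); first by apply: leq_sum.
    by rewrite sum_nat_const cardsT card_ord.
  rewrite defl (_ : 12 * s * Q * _ = 3 * s * (4 * Q * #|K1|)); last by lia.
  by rewrite [X in _ <= X]mulnA [s * 3]mulnC leq_pmul2l // muln_gt0.
have leK2 : 4 * Q * #|K2| <= n ^ 2.
  have le (p : 'I_s * 'I_t) : g * #|[set c in C | (c.1 p.1, c.2 p.2) \in Err :|: bad p.1]|
      <= 4 * h * n ^ 2.
    apply: leq_trans (leq_mul (leqnn g) (card_copies_through _ _ _ disC)) _.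
    apply: leq_trans (leq_mul (leqnn g) (leq_card_setU _ _).1) _.
    have := card_bad_blocks cl n0 B0 p.1 h M z; rewrite -/Err -/(bad _) => leb.
    apply: (@leq_trans (2 * h * (g * #|Err|))).
      rewrite mulnCA leq_mul2l; apply/orP; right; move: leb.
      by move: #|bad _| #|Err| => a b; nia.
    by rewrite (_ : 4 * h * _ = 2 * h * (2 * n ^ 2)); [rewrite leq_mul2l fewErr orbT | lia].
  have cov : #|K2| <= \sum_(p in [set: 'I_s * 'I_t])
      #|[set c in C | (c.1 p.1, c.2 p.2) \in Err :|: bad p.1]|.
    apply: card_cover => c; rewrite inE => /andP[cC /existsP[i /existsP[j hij]]].
    by exists (i, j); [rewrite inE | rewrite inE cC].
  have : g * #|K2| <= s * t * (4 * h * n ^ 2).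
    apply: leq_trans (leq_mul (leqnn g) cov) _; rewrite big_distrr /=.
    apply: (@leq_trans (\sum_(p in [set: 'I_s * 'I_t]) 4 * h * n ^ 2)).
      by apply: leq_sum.
    by rewrite sum_nat_const cardsT card_prod !card_ord.
  rewrite {1}defg (_ : _ * h * Q * _ = s * t * (4 * h) * (4 * Q * #|K2|)); last by lia.
  by rewrite [X in _ <= X]mulnA leq_pmul2l // !muln_gt0 s0 t0.
pose S := C :\: (K1 :|: K2).
have manyS : n ^ 2 <= 2 * Q * #|S|.
  have : #|C| <= #|S| + (#|K1| + #|K2|).
    rewrite -(cardsID (K1 :|: K2) C) addnC leq_add2l.
    by apply: leq_trans (leq_card_setU _ _).1; apply/subset_leq_card/subsetIr.
  move=> leC; have := leq_trans manyC (leq_mul (leqnn Q) leC).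
  by move: leK1 leK2; rewrite !mulnDr; lia.
have S0 : 0 < #|S|.
  by rewrite lt0n; apply/eqP => e; move: manyS; rewrite e muln0 leqNgt expn_gt0 n0.
pose cidx := @cell_index n r B cl n0 B0.
(* A level-[s] index determines all coarser ones, so copies with equal [kap] share their cells at
   every level up to [s]. *)
pose kap (c : loc s t n) := [ffun i => cidx s (c.1 i)].
have [u manyS'] := pigeonhole kap S0; set S' := [set x in S | _] in manyS'.
rewrite card_ffun card_prod !card_ord in manyS'.
have S'0 : 0 < #|S'|.
  by rewrite lt0n; apply/eqP => e; move: manyS' S0; rewrite e muln0; case: #|S|.
have S'C c : c \in S' -> c \in C by rewrite !inE => /andP[/andP[]].
have copyS' c : c \in S' -> is_copy A M c by move=> /S'C; case: disC => h1 _; apply: h1.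
have goodR c (i : 'I_s) : c \in S' ->
    n <= l * r * B ^ i * #|cell B cl i (c.1 i)| /\
    #|cell B cl i (c.1 i)| <= l * #|low_cell B cl i (c.1 i)|.
  rewrite inE in_setD in_setU negb_or => /andP[/andP[/andP[nK _] cC] _]; move: nK.
  rewrite inE cC negb_exists => /forallP/(_ i); rewrite !inE negb_or -leqNgt => /andP[h1].
  by rewrite h1 /= -leqNgt.
have goodE c (i : 'I_s) (j : 'I_t) : c \in S' ->
    M (c.1 i) (c.2 j) = M (z (cl (c.1 i))) (c.2 j) /\
    h * #|[set x in cell B cl i (c.1 i) | M x (c.2 j) != M (z (cl (c.1 i))) (c.2 j)]|
      <= #|cell B cl i (c.1 i)|.
  rewrite inE in_setD in_setU negb_or => /andP[/andP[/andP[_ nK] cC] _]; move: nK.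
  rewrite inE cC negb_exists => /forallP/(_ i); rewrite negb_exists => /forallP/(_ j).
  by rewrite in_setU negb_or !inE /= negbK -leqNgt => /andP[/eqP].
have [c0 c0S'] : exists c, c \in S' by apply/card_gt0P.
have type_eq c (i : 'I_s) : c \in S' -> cl (c.1 i) = cl (c0.1 i) /\
    forall k, k <= s -> slab B k (c.1 i) = slab B k (c0.1 i).
  move=> cS'; have : kap c = kap c0.
    by move: cS' c0S'; rewrite !inE => /andP[_ /eqP->] /andP[_ /eqP->].
  move=> /ffunP/(_ i); rewrite !ffunE => -[e1 e2]; split=> // k ks.
  by rewrite !(slab_nested B0 _ ks) e2.
(* This rounding keeps [t * K < #|S'|] strict while [#|S'| <= t * K.+1]. *)
pose K := #|S'|.-1 %/ t.
have ltK : t * K < #|S'|.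
  by rewrite mulnC; apply: leq_ltn_trans (leq_trunc_div _ _) _; rewrite prednK.
have incS' c : c \in S' -> forall i j : 'I_t, i < j -> c.2 i < c.2 j.
  move=> /copyS'/and3P[_ /forallP inc _] i j ij.
  by have /forallP/(_ j)/implyP/(_ ij) := inc i.
have multS' (j : 'I_t) v : #|[set c in S' | c.2 j == v]| <= n.
  rewrite -[X in _ <= X]muln1 -[X in _ <= X * _]card_ord -cardsT -(cards1 v) -cardsX.
  apply: leq_trans (card_copies_through i0 j _ disC).
  by apply/subset_leq_card/subsetP => c; rewrite 2!inE => /andP[/S'C cC /eqP<-]; rewrite !inE cC /=.
have [Y [manyY Ysub Yinc]] := increasing_boxes incS' multS' ltK.
pose X (i : 'I_s) := low_cell B cl i (c0.1 i).
(* [v] is below the level-[i.+1] interval of [c0.1 i], while [w] lies in that of [c0.1 j], because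
   level [j] refines level [i.+1]. *)
have Xinc (i j : 'I_s) v w : i < j -> v \in X i -> w \in X j -> v < w.
  move=> ij; rewrite !inE => /andP[_ ltv] /andP[/andP[_ /eqP ew] _].
  have /and3P[/forallP inc _ _] := copyS' _ c0S'.
  have /forallP/(_ j)/implyP/(_ ij) ltx := inc i.
  rewrite ltnNge; apply/negP => /(slab_leq B i.+1); apply/negP; rewrite -ltnNge.
  apply: leq_trans ltv _; rewrite (slab_nested B0 w ij) ew -(slab_nested B0 _ ij).
  by apply: slab_leq; apply: ltnW.
(* The column may come from another copy [c], but [c] shares the cell of [c0], and the center's
   entry in that column is [A i j]. *)
have err (i : 'I_s) (j : 'I_t) y : y \in Y j ->
    2 * (s * t) * #|[set x in X i | M x y != A i j]| <= #|X i|.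
  move=> /Ysub[c cS' <-]; have [e1 e2] := goodE c i j cS'.
  have [_ lel] := goodR c0 i c0S'.
  have /and3P[_ _ /forallP/(_ i)/forallP/(_ j)/eqP eA] := copyS' _ cS'.
  have [ecl eslab] := type_eq c i cS'.
  have ecell : cell B cl i (c.1 i) = cell B cl i (c0.1 i).
    by apply/setP => x; rewrite !inE ecl eslab // ltnW.
  rewrite -(leq_pmul2l l0); apply: leq_trans lel; rewrite -ecell; apply: leq_trans e2.
  rewrite mulnA [l * _]mulnC -defh leq_mul2l; apply/orP; right.
  apply/subset_leq_card/subsetP => x; rewrite inE => /andP[xX ne].
  have xc : x \in cell B cl i (c0.1 i) by move: xX; rewrite inE => /andP[].
  by rewrite inE ecell xc -e1 eA.
have cnt := box_copies Xinc Yinc err st0.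
have leX (i : 'I_s) : n <= l ^ 2 * r * B ^ s * #|X i|.
  have [le1 le2] := goodR c0 i c0S'; apply: leq_trans le1 _.
  apply: (@leq_trans (l * r * B ^ s * (l * #|X i|))).
    by rewrite leq_mul // leq_mul // leq_pexp2l // ltnW.
  by rewrite -mulnn; apply: eq_leq; lia.
have leY (j : 'I_t) : n <= 2 * Q * (r * B ^ s) ^ s * t * #|Y j|.
  have leS' : #|S'| <= t * n * #|Y j|.
    rewrite -mulnA; apply: leq_trans (leq_mul (leqnn t) (manyY j)).
    by have := ltn_ceil #|S'|.-1 t0; rewrite -/K prednK // mulnC.
  rewrite -(leq_pmul2l n0) mulnn; apply: leq_trans manyS _.
  apply: leq_trans (leq_mul (leqnn _) manyS') _.
  apply: leq_trans (leq_mul (leqnn _) (leq_mul (leqnn _) leS')) _.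
  by apply: eq_leq; lia.
rewrite expnD.
apply: (@leq_trans ((\prod_(i < s) (l ^ 2 * r * B ^ s * #|X i|)) *
                    (\prod_(j < t) (2 * Q * (r * B ^ s) ^ s * t * #|Y j|)))).
  by apply: leq_mul; rewrite -[X in _ ^ X]card_ord -prod_nat_const; apply: leq_prod.
have pull k a (F : 'I_k -> nat) : \prod_i (a * F i) = a ^ k * \prod_i F i.
  by rewrite big_split /= prod_nat_const card_ord.
rewrite !pull mulnACA; apply: leq_trans (leq_mul (leqnn _) cnt) _.
by rewrite mulnCA !mulnA.
Qed.

(** * Polynomial dependence of the constants *)

Definition poly_bounded (f : nat -> nat) :=
  exists c d, forall Q, f Q <= c * Q.+1 ^ d.

Lemma poly_bounded_const a : poly_bounded (fun=> a).
Proof. by exists a, 0 => Q; rewrite muln1. Qed.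

Lemma poly_bounded_id : poly_bounded id.
Proof. by exists 1, 1 => Q; rewrite mul1n expn1. Qed.

Lemma poly_boundedD f g :
  poly_bounded f -> poly_bounded g -> poly_bounded (fun Q => f Q + g Q).
Proof.
move=> [c [d hf]] [c' [d' hg]]; exists (c + c'), (d + d') => Q.
(* Exponents may be raised because the base [Q.+1] is positive. *)
rewrite mulnDl; apply: leq_add; [apply: leq_trans (hf Q) _ | apply: leq_trans (hg Q) _];
  by rewrite leq_mul2l leq_pexp2l ?orbT ?leq_addr ?leq_addl.
Qed.

Lemma poly_boundedM f g :
  poly_bounded f -> poly_bounded g -> poly_bounded (fun Q => f Q * g Q).
Proof.
move=> [c [d hf]] [c' [d' hg]]; exists (c * c'), (d + d') => Q.
by apply: leq_trans (leq_mul (hf Q) (hg Q)) _; rewrite expnD mulnACA.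
Qed.

Lemma poly_boundedX f k : poly_bounded f -> poly_bounded (fun Q => f Q ^ k).
Proof.
move=> [c [d hf]]; exists (c ^ k), (d * k) => Q.
by rewrite expnM -expnMn; case: k => // k; rewrite leq_exp2r.
Qed.

Lemma matrix_removal s t (A : 'M[bool]_(s, t)) : 0 < s -> 0 < t ->
  exists c d, forall Q n (M : 'M[bool]_n) (C : {set loc s t n}),
    0 < Q -> 0 < n -> disjoint_copies A M C -> n ^ 2 <= Q * #|C| ->
    n ^ (s + t) <= c * Q.+1 ^ d * num_copies A M.
Proof.
move=> s0 t0; pose D := s * (s + t).
pose l Q := 12 * s * Q; pose h Q := 2 * (s * t) * l Q; pose g Q := 16 * (s * t) * h Q * Q.
pose m Q := sample_width D (g Q); pose r Q := sample_height D (g Q).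
pose B Q := 2 * l Q ^ 2 * r Q.
(* The summands serve, in order, small [n], the far-rows case and the clustered case. For small [n]
   a single copy suffices. *)
pose bound Q := B Q ^ (s * (s + t)) + (2 * (g Q * r Q) ^ s * m Q ^ t +
  2 * (l Q ^ 2 * r Q * B Q ^ s) ^ s * (2 * Q * (r Q * B Q ^ s) ^ s * t) ^ t).
have [c [d bnd]] : poly_bounded bound.
  have cst := poly_bounded_const; have idP := poly_bounded_id.
  have lP : poly_bounded l by apply: poly_boundedM.
  have gP : poly_bounded g by do 2!apply: poly_boundedM => //; apply: poly_boundedM.
  have mP : poly_bounded m.
    do 2!apply: poly_boundedM => //.
    by apply: poly_boundedD => //; apply: poly_boundedM.
  have rP : poly_bounded r.
    have [c [d h']] := poly_boundedX D (poly_boundedD mP (cst 1)).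
    by apply: poly_boundedD (cst 1) _; exists c, d => Q; rewrite -addn1; apply: h'.
  have BP : poly_bounded B.
    by apply: poly_boundedM => //; apply: poly_boundedM => //; apply: poly_boundedX.
  apply: poly_boundedD; first exact: poly_boundedX.
  apply: poly_boundedD.
    apply: poly_boundedM; last exact: poly_boundedX.
    by apply: poly_boundedM => //; apply: poly_boundedX; apply: poly_boundedM.
  have BsP : poly_bounded (fun Q => B Q ^ s) by apply: poly_boundedX.
  apply: poly_boundedM.
    apply: poly_boundedM => //; apply: poly_boundedX; apply: poly_boundedM => //.
    by apply: poly_boundedM => //; apply: poly_boundedX.
  apply: poly_boundedX; apply: poly_boundedM => //; apply: poly_boundedM.
    exact: poly_boundedM.
  by apply: poly_boundedX; apply: poly_boundedM.
exists c, d => Q n M C Q0 n0 disC manyC.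
suff : n ^ (s + t) <= bound Q * num_copies A M.
  by move=> /leq_trans; apply; rewrite leq_mul2r bnd orbT.
have l0 : 0 < l Q by rewrite !muln_gt0 s0.
have g0 : 0 < g Q by rewrite !muln_gt0 s0 t0 Q0.
rewrite /bound mulnDl [X in _ <= _ + X]mulnDl; have [small|large] := ltnP n (B Q ^ s).
  apply: leq_trans (leq_addr _ _).
  have : 0 < num_copies A M.
    have /card_gt0P[x xC] : 0 < #|C|.
      by rewrite lt0n; apply/eqP => e; move: manyC; rewrite e muln0 leqNgt expn_gt0 n0.
    by apply/card_gt0P; exists x; rewrite inE; case: disC => copyC _; apply: copyC.
  move=> N0; apply: leq_trans (leq_pmulr _ N0).
  by rewrite expnM leq_exp2r ?addn_gt0 ?s0 // ltnW.
apply: leq_trans (leq_addl _ _).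
have [many|[Z ltZ few]] := row_clustering A M s0 g0 n0.
  by apply: leq_trans (leq_addr _ _); exact: many.
have [cl [z fewErr]] := cluster_centers n0 ltZ few.
apply: leq_trans (leq_addl _ _).
exact: (copies_from_clusters s0 t0 n0 Q0 _ _ _ _ large disC manyC fewErr).
Qed.

(** * Passage from integer to real density *)

Import Order.TTheory GRing.Theory Num.Theory.
Local Open Scope ring_scope.

Theorem theorem1p2 (R : realType) (s t : nat) (A : 'M[bool]_(s, t)) :
  (0 < s)%N -> (0 < t)%N ->
  exists p : {poly R},
    (forall x : R, 0 < x -> 0 < p.[x]) /\
    forall eps : R, 0 < eps ->
      let delta := (p.[eps^-1])^-1 in
      forall (n : nat) (M : 'M[bool]_(n, n)),
        (exists C : {set loc s t n},
            disjoint_copies A M C /\ eps * (n ^ 2)%:R <= (#|C|)%:R) ->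
        delta * (n ^ (s + t))%:R <= (num_copies A M)%:R.
Proof.
move=> s0 t0; have [c [d removal]] := matrix_removal A s0 t0.
(* With [Q] the integer just above [1 / eps], [Q.+1] is at most [1 / eps + 2], whence the shift by
   2; [c.+1] keeps [p] positive even when [c = 0]. *)
pose p : {poly R} := c.+1%:R *: ('X + 2%:P) ^+ d.
have pE x : p.[x] = c.+1%:R * (x + 2) ^+ d by rewrite /p !hornerE.
have p0 x : 0 < x -> 0 < p.[x].
  by move=> x0; rewrite pE mulr_gt0 ?ltr0n // exprn_gt0 // addr_gt0.
exists p; split => // eps eps0 delta n M [C [disC manyC]].
case: n => [|n] in M C disC manyC *; first by rewrite exp0n ?addn_gt0 ?s0 // mulr0.
have inv0 : 0 < eps^-1 by rewrite invr_gt0.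
pose Q := (Num.truncn eps^-1).+1.
have /andP[leQ ltQ] := truncn_itv (ltW inv0).
rewrite /delta mulrC ler_pdivrMr ?p0 //.
have many : (n.+1 ^ 2 <= Q * #|C|)%N.
  rewrite -(ler_nat R) natrM; apply: le_trans (_ : eps^-1 * #|C|%:R <= _).
    by rewrite mulrC ler_pdivlMr // mulrC.
  by rewrite ler_wpM2r // ltW.
have := removal Q n.+1 M C isT isT disC many.
rewrite -(ler_nat R) natrM => /le_trans; apply; rewrite mulrC ler_wpM2l //.
rewrite pE natrM natrX ler_pM ?exprn_ge0 ?ler_nat //.
rewrite lerXn2r ?nnegrE //; first by rewrite addr_ge0 // ltW.
by rewrite /Q -addn2 natrD lerD2r.
Qed.
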